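(* Let $h>0$, let $\alpha,\gamma>0$ and let $\kappa,\sigma,\rho$ be nonzero real constants with $\sigma=-1/(\gamma\kappa)$, and let $\beta,V_1$ (functions of $\phi$), $V_2$ (function of $s$) and $V_\epsilon$ (function of one real variable) be smooth near $0$, with $V_1'(0)=0$, $V_1''(0)<0$, $V_\epsilon$ negative-definite, and $\alpha\gamma-\beta^2(0)\neq0$. Consider the discrete system $$\frac{\partial L^d_{\tau,\sigma,\rho,\epsilon}(q_k,q_{k+1})}{\partial\phi_k}+\frac{\partial L^d_{\tau,\sigma,\rho,\epsilon}(q_{k-1},q_k)}{\partial\phi_k}=-w_k,\qquad \frac{\partial L^d_{\tau,\sigma,\rho,\epsilon}(q_k,q_{k+1})}{\partial s_k}+\frac{\partial L^d_{\tau,\sigma,\rho,\epsilon}(q_{k-1},q_k)}{\partial s_k}=0,$$ where $$w_k=\Big(1-\sigma+\frac{\sigma}{\rho}\Big)\Big(\tau(\phi_{k+\frac12})\Big[J_k+\frac h2V_\epsilon'(y_{k+\frac12})\Big]+\tau(\phi_{k-\frac12})\Big[-J_{k-1}+\frac h2V_\epsilon'(y_{k-\frac12})\Big]-\tfrac12\tau'(\phi_{k+\frac12})J_k\Delta\phi_k-\tfrac12\tau'(\phi_{k-\frac12})J_{k-1}\Delta\phi_{k-1}\Big).$$ If $$-\frac{\beta^2(0)}{\alpha\gamma-\beta^2(0)}<\sigma<0,\qquad \rho<0,\qquad V_\epsilon''(0)<0,$$ then the equilibrium $(\phi_k,s_k)=(0,0)$ of this system is spectrally stable.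
   Context: Configuration variables are $q=(\phi,s)$, where $\phi$ (shape variable) ranges over an open interval containing $0$ and $s\in\mathbb{R}$ (group variable). For a sequence $q_k=(\phi_k,s_k)$ write $q_{k+1/2}=(q_k+q_{k+1})/2$ (componentwise) and $\Delta q_k=q_{k+1}-q_k$. The continuous Lagrangian is $$L(\phi,s,\dot\phi,\dot s)=\tfrac12\big[\alpha\dot\phi^2+2\beta(\phi)\dot\phi\dot s+\gamma\dot s^2\big]-V_1(\phi)-V_2(s).$$ Put $\tau(\phi)=\kappa\beta(\phi)$. The continuous controlled Lagrangian is $$L_{\tau,\sigma,\rho,\epsilon}(\phi,s,\dot\phi,\dot s)=L(\phi,s,\dot\phi,\dot s+\tau(\phi)\dot\phi)+\tfrac12\sigma\gamma(\tau(\phi)\dot\phi)^2+\tfrac12(\rho-1)\gamma\big(\dot s-(\sigma-1)\tau(\phi)\dot\phi\big)^2+V_2(s)-V_\epsilon(y),$$ where $$y=y(\phi,s)=s-\int_0^{\phi}\frac1\gamma\Big(\frac1\sigma-\frac{\rho-1}{\rho}\Big)\beta(z)\,dz,$$ and $L^d_{\tau,\sigma,\rho,\epsilon}(q_k,q_{k+1})=h\,L_{\tau,\sigma,\rho,\epsilon}(q_{k+1/2},\Delta q_k/h)$. Further, $y_{k+\frac12}=y(\phi_{k+\frac12},s_{k+\frac12})$ and $$J_k=\rho\gamma\Big(\frac{\Delta s_k}{h}-(\sigma-1)\tau(\phi_{k+\frac12})\frac{\Delta\phi_k}{h}\Big).$$ A negative-definite function $V_\epsilon$ satisfies $V_\epsilon(0)=0$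 and $V_\epsilon(y)<0$ for $y\neq0$. Spectral stability of the equilibrium means that the linear map $(q_{k-1},q_k)\mapsto(q_k,q_{k+1})$ on $\mathbb{R}^4$ defined by the linearization of the system at $q_k\equiv(0,0)$ has its spectrum contained in the unit circle of $\mathbb{C}$. *)

(* Defs.v *)
From HB Require Import structures.
From mathcomp Require Import all_boot all_order all_algebra.
From mathcomp Require Import all_classical all_reals all_analysis.
From mathcomp.real_closed Require Import complex.
Set Implicit Arguments.
Unset Strict Implicit.
Unset Printing Implicit Defensive.
Import Order.TTheory GRing.Theory Num.Theory.
Import numFieldNormedType.Exports.
Local Open Scope classical_set_scope.
Local Open Scope ring_scope.

Definition smooth_near0 (R : realType) (f : R -> R) : Prop :=
  \forall x \near (0 : R), forall n : nat, derivable (derive1n n f) x 1.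

Definition negative_definite (R : realType) (f : R -> R) : Prop :=
  f 0 = 0 /\ forall y : R, y != 0 -> f y < 0.

(* For [x < 0] the interval `[0, x] is empty, and for [x > 0] so is `[x, 0]. *)
Definition integral_from0 (R : realType) (f : R -> R) (x : R) : R :=
  (\int[lebesgue_measure]_(z in `[0%R, x]) f z
   - \int[lebesgue_measure]_(z in `[x, 0%R]) f z)%R.

Section ControlledLagrangian.
Variables (R : realType) (h alpha gamma kappa sigma rho : R).
Variables (beta V1 V2 Veps : R -> R).

Definition lagrangian (phi s dphi ds : R) : R :=
  2^-1 * (alpha * dphi ^+ 2 + 2 * beta phi * dphi * ds + gamma * ds ^+ 2)
  - V1 phi - V2 s.

Definition tau (phi : R) : R := kappa * beta phi.

Definition shifted_s (phi s : R) : R :=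
  s - integral_from0
        (fun z => gamma^-1 * (sigma^-1 - (rho - 1) / rho) * beta z) phi.

Definition controlled_lagrangian (phi s dphi ds : R) : R :=
  lagrangian phi s dphi (ds + tau phi * dphi)
  + 2^-1 * sigma * gamma * (tau phi * dphi) ^+ 2
  + 2^-1 * (rho - 1) * gamma * (ds - (sigma - 1) * tau phi * dphi) ^+ 2
  + V2 s - Veps (shifted_s phi s).

Definition discrete_lagrangian (phi0 s0 phi1 s1 : R) : R :=
  h * controlled_lagrangian ((phi0 + phi1) / 2) ((s0 + s1) / 2)
                            ((phi1 - phi0) / h) ((s1 - s0) / h).

Definition discrete_momentum (phi0 s0 phi1 s1 : R) : R :=
  rho * gamma * ((s1 - s0) / h
    - (sigma - 1) * tau ((phi0 + phi1) / 2) * ((phi1 - phi0) / h)).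

(* In the definitions below the suffixes m, 0, p stand for the indices
   k - 1, k, k + 1. *)
Definition shape_control (phim sm phi0 s0 phip sp : R) : R :=
  let phi_p := (phi0 + phip) / 2 in
  let phi_m := (phim + phi0) / 2 in
  let y_p := shifted_s phi_p ((s0 + sp) / 2) in
  let y_m := shifted_s phi_m ((sm + s0) / 2) in
  let J_p := discrete_momentum phi0 s0 phip sp in
  let J_m := discrete_momentum phim sm phi0 s0 in
  (1 - sigma + sigma / rho) *
  (tau phi_p * (J_p + h / 2 * derive1 Veps y_p)
   + tau phi_m * (- J_m + h / 2 * derive1 Veps y_m)
   - 2^-1 * derive1 tau phi_p * J_p * (phip - phi0)
   - 2^-1 * derive1 tau phi_m * J_m * (phi0 - phim)).

Definition shape_residual (phim sm phi0 s0 phip sp : R) : R :=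
  derive1 (fun x => discrete_lagrangian x s0 phip sp) phi0
  + derive1 (fun x => discrete_lagrangian phim sm x s0) phi0
  + shape_control phim sm phi0 s0 phip sp.

Definition group_residual (phim sm phi0 s0 phip sp : R) : R :=
  derive1 (fun x => discrete_lagrangian phi0 x phip sp) s0
  + derive1 (fun x => discrete_lagrangian phim sm phi0 x) s0.

(* A configuration (phi, s) is the row vector with entries phi, s; the
   system reads [discrete_system q_(k-1) q_k q_(k+1) = 0] for all k. *)
Definition discrete_system (qm q0 qp : 'rV[R]_2) : 'rV[R]_2 :=
  \row_(i < 2)
    (if i == 0 then shape_residual else group_residual)
      (qm 0 0) (qm 0 1) (q0 0 0) (q0 0 1) (qp 0 0) (qp 0 1).

End ControlledLagrangian.

Section SpectralStability.
Variables (R : realType) (n : nat).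
Implicit Type E : 'rV[R]_n -> 'rV[R]_n -> 'rV[R]_n -> 'rV[R]_n.

Definition linearization E (q : 'rV[R]_n) (u v w : 'rV[R]_n) : 'rV[R]_n :=
  'd (fun x : 'rV[R]_n * 'rV[R]_n * 'rV[R]_n => E x.1.1 x.1.2 x.2)
     (q, q, q) (u, v, w).

(* [A], acting on row vectors from the right, is the matrix of the map
   (u, v) |-> (v, w) determined by the linearized equation.  Taking
   u = v = 0 shows that w |-> linearization E q 0 0 w is injective, hence
   bijective, so the equation is uniquely solvable for w and such an [A] is
   unique when it exists. *)
Definition linearized_step E (q : 'rV[R]_n) (A : 'M[R]_(n + n)) : Prop :=
  forall u v w : 'rV[R]_n,
    linearization E q u v w = 0 <-> row_mx u v *m A = row_mx v w.

(* [q] is an equilibrium of the implicit system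
   [E q_(k-1) q_k q_(k+1) = 0], the linearization at [q] exists and defines a
   map, and the complex spectrum of that map lies in the unit circle. *)
Definition spectrally_stable E (q : 'rV[R]_n) : Prop :=
  [/\ E q q q = 0,
      differentiable
        (fun x : 'rV[R]_n * 'rV[R]_n * 'rV[R]_n => E x.1.1 x.1.2 x.2)
        (q, q, q)
    & exists2 A : 'M[R]_(n + n), linearized_step E q A &
        forall z : R[i],
          eigenvalue (map_mx (real_complex R) A) z -> `|z| = 1].

End SpectralStability.

(* Main.v *)
(* Near the origin the residuals of the system are explicit expressions in beta, V1, Veps and
   their derivatives, so their linearization is computed by first-order jets. In the coordinates
   phi and y = s + (1 - sigma + sigma / rho) tau(0) phi, adding the group equation to the shape
   equation with the weight prescribed by the control turns the linearized system into
     M (q_(k+1) - 2 q_k + q_(k-1)) + K (q_(k+1) + 2 q_k + q_(k-1)) = 0,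
   where the choice sigma = - 1 / (gamma kappa) makes M symmetric, K is diagonal, and the sign
   conditions make both definite of the same sign. Pairing with the conjugate of an eigenvector
   gives (z - 1)^2 m + (z + 1)^2 k = 0 with m, k > 0; this real quadratic has negative
   discriminant and product of roots 1, so |z| = 1. *)
Require Import Defs.
From HB Require Import structures.
From mathcomp Require Import all_boot all_order all_algebra.
From mathcomp Require Import all_classical all_reals all_analysis.
From mathcomp.real_closed Require Import complex.
From mathcomp Require Import ring lra.
Set Implicit Arguments.
Unset Strict Implicit.
Unset Printing Implicit Defensive.
Import Order.TTheory GRing.Theory Num.Theory.
Import numFieldNormedType.Exports.
Local Open Scope classical_set_scope.
Local Open Scope ring_scope.

(** * Implicit midpoint systems *)

Definition posdef (R : realType) (n : nat) (M : 'M[R]_n) : Prop :=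
  M^T = M /\ forall x : 'rV[R]_n, x != 0 -> 0 < (x *m M *m x^T) 0 0.

Lemma posdefD (R : realType) (n : nat) (M N : 'M[R]_n) :
  posdef M -> posdef N -> posdef (M + N).
Proof.
move=> [sM pM] [sN pN]; split; first by rewrite linearD /= sM sN.
by move=> x x0; rewrite mulmxDr mulmxDl mxE addr_gt0 ?pM ?pN.
Qed.

(** A nonzero vector of the kernel would give the quadratic form the value 0. *)
Lemma posdef_unitmx (R : realType) (n : nat) (M : 'M[R]_n) :
  posdef M -> M \in unitmx.
Proof.
move=> [_ pM]; rewrite -row_free_unit -kermx_eq0; apply/eqP/row_matrixP => i.
rewrite row0; apply/eqP; apply: contraT => /pM.
have /sub_kermxP -> : (row i (kermx M) <= kermx M)%MS by exact: row_sub.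
by rewrite mul0mx mxE ltxx.
Qed.

(** Write [x] as [a + i b] with [a], [b] real. Symmetry of [M] cancels the imaginary cross terms and
    leaves the sum of the real forms at [a] and [b], which are not both zero. *)
Lemma posdef_hermitian (R : realType) (n : nat) (M : 'M[R]_n) (x : 'rV[R[i]]_n) :
  posdef M -> x != 0 ->
  exists2 m : R, 0 < m &
    x *m map_mx (real_complex R) M *m (map_mx (@conjc R) x)^T
    = (real_complex R m)%:M.
Proof.
move=> [sM pM] x0.
pose a := map_mx (@complex.Re R) x; pose b := map_mx (@complex.Im R) x.
pose c m p (A : 'M[R]_(m, p)) := map_mx (real_complex R) A.
have xE : x = c _ _ a + 'i%C *: c _ _ b.
  by apply/matrixP => i j; rewrite !mxE -complexE.
have xJE : map_mx (@conjc R) x = c _ _ a - 'i%C *: c _ _ b.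
  apply/matrixP => i j; rewrite !mxE; case: (x i j) => p q /=.
  by simpc.
clearbody a b; exists ((a *m M *m a^T) 0 0 + (b *m M *m b^T) 0 0).
  have [a0|a0] := eqVneq a 0; have [b0|b0] := eqVneq b 0.
  - move: x0; rewrite xE a0 b0 /c !map_mx0 scaler0 addr0 eqxx //.
  - by rewrite a0 !mul0mx mxE add0r pM.
  - by rewrite b0 !mul0mx [in X in _ + X]mxE addr0 pM.
  - by rewrite addr_gt0 ?pM.
have swap : b *m M *m a^T = a *m M *m b^T.
  rewrite [LHS]mx11_scalar -tr_scalar_mx -mx11_scalar.
  by rewrite !trmx_mul trmxK sM mulmxA.
rewrite xJE linearB /= linearZ /= [in LHS]xE !map_trmx /c.
rewrite mulmxDl mulmxBr !mulmxDl -!scalemxAr -!scalemxAl -!map_mxM swap.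
rewrite opprD scalerA -expr2 sqr_i scaleN1r opprK.
rewrite addrA addrK.
rewrite [LHS]mx11_scalar; congr (_%:M); rewrite mxE rmorphD; congr (_ + _); exact: mxE.
Qed.

Lemma unit_circle_quadratic (R : realType) (m k : R) (z : R[i]) :
  0 < m -> 0 < k ->
  (z - 1) ^+ 2 * real_complex R m + (z + 1) ^+ 2 * real_complex R k = 0 ->
  `|z| = 1.
Proof.
move=> m0 k0; case: z => a b; rewrite normc_def /= !expr2.
simpc => /eqP; rewrite eq_complex /= => /andP[/eqP re /eqP im].
have -> : a * a + b * b = 1; last by rewrite sqrtr1.
(* A real root would annihilate a sum of two nonnegative terms, forcing both [a = 1] and
   [a = - 1]. *)
have [b0|b0] := eqVneq b 0.
  subst b.
  have : m * (a - 1) ^+ 2 + k * (a + 1) ^+ 2 = 0 by move: re; rewrite !expr2; lra.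
  have := sqr_ge0 (a - 1); have := sqr_ge0 (a + 1) => p q.
  move/eqP; rewrite paddr_eq0 ?(pmulr_rge0 _ m0) ?(pmulr_rge0 _ k0) //.
  rewrite !expr2 !mulf_eq0 (gt_eqF m0) (gt_eqF k0) /= !orbb.
  by move=> /andP[/eqP ? /eqP ?]; lra.
(* The imaginary part is [2 b (a (m + k) - (m - k))]. Once [b] is divided out, substituting for
   [m - k] in the real part gives [(m + k) (a ^ 2 + b ^ 2) = m + k]. *)
have amk : a * (m + k) = m - k.
  by apply: (mulfI b0); lra.
have mk0 : m + k != 0 by rewrite gt_eqF // addr_gt0.
by apply: (mulfI mk0); move: re amk; nra.
Qed.

(** [T] is a change of coordinates on configurations. An eigenvector of the step map is determined
    by its first block [u], and both forms are evaluated at [u *m T]. *)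
Lemma midpoint_spectrally_stable (R : realType) (n : nat)
    (E : 'rV[R]_n -> 'rV[R]_n -> 'rV[R]_n -> 'rV[R]_n) (T M K : 'M[R]_n) :
  T \in unitmx -> posdef M -> posdef K -> E 0 0 0 = 0 ->
  differentiable
    (fun x : 'rV[R]_n * 'rV[R]_n * 'rV[R]_n => E x.1.1 x.1.2 x.2) (0, 0, 0) ->
  (forall u v w, linearization E 0 u v w =
     (u - 2 *: v + w) *m T *m M + (u + 2 *: v + w) *m T *m K) ->
  spectrally_stable E 0.
Proof.
move=> uT pM pK E0 dE lE; split => //.
pose C := T *m (M + K); pose B := 2 *: (T *m (K - M)).
have uC : C \in unitmx by rewrite unitmx_mul uT posdef_unitmx //; exact: posdefD.
have {}lE u v w : linearization E 0 u v w = (u + w) *m C + v *m B.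
  rewrite lE /C /B -!mulmxA !mulmxDl !mulNmx -!scalemxAr -!scalemxAl.
  rewrite !mulmxDr !mulmxN !scalerDr !scalerN.
  apply/matrixP => i j; rewrite !mxE; ring.
(* The block companion matrix, in row convention, of the recurrence
   [w = - u - v *m B *m invmx C]. *)
exists (block_mx 0 (- 1%:M) 1%:M (- (B *m invmx C))).
  move=> u v w; rewrite lE mul_row_block !mulmx0 !mulmx1 add0r !mulmxN mulmx1.
  rewrite [v *m (B *m _)]mulmxA; split => [e|/eq_row_mx[_ <-]].
    congr row_mx; apply: (can_inj (mulmxK uC)).
    rewrite mulmxDl !mulNmx mulmxKV //; apply/eqP.
    by rewrite -subr_eq0 -opprB oppr_eq0 opprD !opprK addrA -mulmxDl [w + u]addrC e.
  by rewrite addrA subrr add0r mulNmx mulmxKV // addNr.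
move=> z /eigenvalueP[x xA x0].
pose c p q (X : 'M[R]_(p, q)) := map_mx (real_complex R) X.
rewrite -[x]hsubmxK in xA x0; move: (lsubmx x) (rsubmx x) xA x0 => u v.
rewrite map_block_mx map_mx0 map_mxN !map_mx1 map_mxN map_mxM map_invmx.
rewrite mul_row_block !mulmx0 !mulmx1 add0r !mulmxN mulmx1 scale_row_mx.
move=> /eq_row_mx[-> e] uv0.
(* The first block of the eigenvalue equation has made the eigenvector [(u, z *: u)], so [u] cannot
   vanish. *)
have u0 : u != 0.
  by apply: contraNneq uv0 => ->; rewrite scaler0 row_mx0.
pose y := u *m c _ _ T.
have y0 : y != 0.
  apply: contraNneq u0 => y0; rewrite -[u](mulmxK (_ : c _ _ T \in unitmx)) ?map_unitmx //.
  by rewrite -/y y0 mul0mx.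
have eC : (z ^+ 2 + 1) *: (u *m c _ _ C) + z *: (u *m c _ _ B) = 0.
  have : (z *: (z *: u) + u) *m c _ _ C + z *: (u *m c _ _ B) = 0.
    rewrite -e addrAC addNr add0r mulNmx -scalemxAl -scalemxAl mulmxA mulmxKV ?map_unitmx //.
    by rewrite addNr.
  by move=> <-; rewrite mulmxDl -!scalemxAl scalerA -expr2 scalerDl scale1r.
(* This regroups [(z ^ 2 + 1) (M + K) + 2 z (K - M)] by [M] and [K]. *)
have eMK : (z - 1) ^+ 2 *: (y *m c _ _ M) + (z + 1) ^+ 2 *: (y *m c _ _ K) = 0.
  rewrite -eC /B /C /c map_mxZ !map_mxM map_mxB map_mxD -scalemxAr !mulmxA -/y.
  rewrite mulmxBr mulmxDr rmorph_nat.
  by apply/matrixP => i j; rewrite !mxE; ring.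
have [m m0 mE] := posdef_hermitian pM y0.
have [k k0 kE] := posdef_hermitian pK y0.
apply: (unit_circle_quadratic m0 k0).
have := congr1 (fun X => (X *m (map_mx (@conjc R) y)^T) 0 0) eMK.
by rewrite mulmxDl -!scalemxAl mE kE mul0mx !mxE eqxx !mulr1n.
Qed.

(** * Two-by-two matrices *)

Definition mx2 (R : realType) (a b c d : R) : 'M[R]_2 :=
  \matrix_(i < 2, j < 2)
    (if i == 0 then if j == 0 then a else b else if j == 0 then c else d).

Lemma mulmx_mx2 (R : realType) (a b c d : R) (x : 'rV[R]_2) :
  x *m mx2 a b c d = \row_(i < 2)
    (if i == 0 then x 0 0 * a + x 0 1 * c else x 0 0 * b + x 0 1 * d).
Proof.
apply/rowP => i; rewrite !mxE big_ord_recl big_ord1 !mxE /=.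
rewrite (_ : lift ord0 ord0 = 1); last exact/val_inj.
by case: (i == 0).
Qed.

(* Completing the square: d (a x^2 + 2 b x y + d y^2) = (a d - b^2) x^2 + (b x + d y)^2. *)
Lemma posdef_mx2 (R : realType) (a b d : R) :
  0 < d -> b ^+ 2 < a * d -> posdef (mx2 a b b d).
Proof.
move=> d0 det; split.
  by apply/matrixP => i j; rewrite !mxE; case: (i == 0); case: (j == 0).
move=> x x0; rewrite mulmx_mx2 mxE big_ord_recl big_ord1 !mxE /=.
rewrite (_ : lift ord0 ord0 = 1); last exact/val_inj.
rewrite -(pmulr_rgt0 _ d0).
have -> : d * ((x 0 0 * a + x 0 1 * b) * x 0 0 + (x 0 0 * b + x 0 1 * d) * x 0 1)
   = (a * d - b ^+ 2) * x 0 0 ^+ 2 + (x 0 0 * b + x 0 1 * d) ^+ 2 by ring.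
have det0 : 0 < a * d - b ^+ 2 by rewrite subr_gt0.
have [x00|x00] := eqVneq (x 0 0) 0.
  have x01 : x 0 1 != 0.
    apply: contraNneq x0 => x01; apply/eqP/rowP => i; rewrite !mxE.
    case: i => [[|[|//]] lti].
      by rewrite -[RHS]x00; congr (x 0 _); exact/val_inj.
    by rewrite -[RHS]x01; congr (x 0 _); exact/val_inj.
  by rewrite x00 !mul0r expr0n /= mulr0 !add0r exprn_even_gt0 //= mulf_neq0 // gt_eqF.
by rewrite ltr_wpDr ?sqr_ge0 // mulr_gt0 // exprn_even_gt0.
Qed.

Lemma mx2_shear_unit (R : realType) (m : R) : mx2 1 m 0 1 \in unitmx.
Proof.
have := @mulmx1_unit _ _ (mx2 1 m 0 1) (mx2 1 (- m) 0 1); case=> //.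
apply/matrixP => i j; rewrite !mxE big_ord_recl big_ord1 !mxE.
case: i => [[|[|//]] lti]; case: j => [[|[|//]] ltj] /=;
  by rewrite ?(mul0r, mulr0, mul1r, mulr1, addr0, add0r, addNr).
Qed.

(** * First-order calculus *)

Section Calculus.
Variable R : realType.
Implicit Types f g : R -> R.

(** This rule and the next ones are stated for explicit formulas in [t], so that an expression can
    be differentiated by following its syntax. *)
Lemma is_derive1D f g (x df dg : R) :
  is_derive x 1 f df -> is_derive x 1 g dg ->
  is_derive x 1 (fun t => f t + g t) (df + dg).
Proof. by move=> ? ?; exact: is_deriveD. Qed.

Lemma is_derive1N f (x df : R) :
  is_derive x 1 f df -> is_derive x 1 (fun t => - f t) (- df).
Proof. by move=> ?; exact: is_deriveN. Qed.

Lemma is_derive1M f g (x df dg : R) :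
  is_derive x 1 f df -> is_derive x 1 g dg ->
  is_derive x 1 (fun t => f t * g t) (f x * dg + g x * df).
Proof. by move=> ? ?; exact: is_deriveM. Qed.

Lemma is_derive1X2 f (x df : R) :
  is_derive x 1 f df -> is_derive x 1 (fun t => f t ^+ 2) (2 * f x * df).
Proof.
move=> h; have := is_derive1M h h.
by rewrite (_ : (fun t => f t * f t) = (fun t => f t ^+ 2)) // -mulrDl -mulr2n mulr_natl.
Qed.

Lemma is_derive1_comp f g (x df dg : R) :
  is_derive x 1 f df -> is_derive (f x) 1 g dg ->
  is_derive x 1 (fun t => g (f t)) (dg * df).
Proof.
move=> [f1 <-] [g1 <-]; rewrite -[fun t => g (f t)]/(g \o f).
apply: DeriveDef; last by rewrite -!derive1E (derive1_comp f1 g1).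
apply/derivable1_diffP; apply: differentiable_comp; exact/derivable1_diffP.
Qed.

Lemma is_derive1_derivable f (x : R) :
  derivable f x 1 -> is_derive x 1 f (derive1 f x).
Proof. by move=> df; rewrite derive1E; exact/derivableP. Qed.

End Calculus.

Lemma smooth_is_derive (R : realType) (f : R -> R) n :
  smooth_near0 f -> is_derive (0 : R) 1 (derive1n n f) (derive1n n.+1 f 0).
Proof.
by move=> /nbhs_singleton /(_ n) df; rewrite derive1nS; exact: is_derive1_derivable.
Qed.

Lemma smooth_derivable (R : realType) (f : R -> R) :
  smooth_near0 f -> \forall x \near (0 : R), derivable f x 1.
Proof. by apply: filterS => x /(_ 0%N). Qed.

(** Negative definiteness makes 0 a maximum, where the derivative vanishes by Fermat's theorem. For
    [Veps] this shows that the origin is an equilibrium of the added potential. *)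
Lemma smooth_max_derive1 (R : realType) (f : R -> R) :
  smooth_near0 f -> negative_definite f -> derive1 f 0 = 0.
Proof.
move=> sf [f0 fneg]; have /nbhs_normP[e /= e0 df] := smooth_derivable sf.
have I0 : (0 : R) \in `](- e), e[ by rewrite in_itv /= oppr_lt0 e0.
suff [_ d0] : is_derive (0 : R) 1 f 0 by rewrite derive1E d0.
apply: (@derive1_at_max _ f (- e) e 0) => //; first by rewrite ge0_cp ?ltW.
- move=> t; rewrite in_itv /= => te; apply: df.
  by rewrite /ball_ /= sub0r normrN ltr_norml.
move=> t _; have [->//|t0] := eqVneq t 0.
by rewrite f0 ltW // fneg.
Qed.

(** * The integral in the shifted group variable *)

Lemma integral_from0_0 (R : realType) (f : R -> R) : integral_from0 f 0 = 0.
Proof. by rewrite /integral_from0 subrr. Qed.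

(** Moving the base point to some [a <= 0] treats both signs of [x] at once and yields integrals
    with a fixed lower endpoint, as in the fundamental theorem of calculus. *)
Lemma integral_from0B (R : realType) (f : R -> R) (a u x : R) :
  lebesgue_measure.-integrable `[a, u] (EFin \o f) ->
  a <= 0 <= u -> a <= x <= u ->
  integral_from0 f x = parameterized_integral lebesgue_measure a x f
                       - parameterized_integral lebesgue_measure a 0 f.
Proof.
move=> fi /andP[a0 u0] /andP[ax xu]; rewrite /integral_from0 /parameterized_integral.
have sub (b c : itv_bound R) : (BLeft a <= b)%O -> (c <= BRight u)%O ->
    lebesgue_measure.-integrable [set` Interval b c] (EFin \o f).
  by move=> ab cu; apply: integrableS fi => //; apply: subset_itv.
have split (s t : R) : a <= s -> s <= t -> t <= u ->
    (\int[lebesgue_measure]_(z in `[a, t]) f z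
     - \int[lebesgue_measure]_(z in `[a, s]) f z
     = \int[lebesgue_measure]_(z in `[s, t]) f z)%R.
  move=> as_ st tu.
  have -> := @Rintegral_itvB R f (BLeft a) (BRight t) s; rewrite ?bnd_simp //.
    by apply: Rintegral_itv_obnd_cbnd; apply: sub; rewrite bnd_simp.
  by apply: sub; rewrite ?bnd_simp.
have void (s t : R) : s <= t -> (\int[lebesgue_measure]_(z in `[t, s]) f z = 0)%R.
  rewrite le_eqVlt => /predU1P[->|st]; first by rewrite set_itv1 Rintegral_set1.
  by rewrite set_itv_ge ?bnd_simp -?ltNge // Rintegral_set0.
(* For either sign of [x], one of the two integrals runs over an empty interval or a single point
   and vanishes. *)
have [x0|/ltW x0] := leP 0 x.
  by rewrite (split 0 x) // (void 0 x) // subr0.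
by rewrite -[RHS]opprB (split x 0) // (void x 0) // sub0r.
Qed.

(** The derivative is obtained on a whole neighbourhood of 0, because the residuals differentiate
    the Lagrangian at all configurations near the equilibrium. *)
Lemma is_derive_integral_from0 (R : realType) (f : R -> R) :
  (\forall x \near (0 : R), {for x, continuous f}) ->
  \forall x \near (0 : R), is_derive (x : R) 1 (integral_from0 f) (f x).
Proof.
move=> /nbhs_normP[e /= e0 fc].
(* Halving the radius puts the closed interval from [a] to [u] inside the open ball where [f] is
   continuous. *)
pose a := - (e / 2); pose u := e / 2.
have e2 : 0 < e / 2 by rewrite divr_gt0.
have fi : lebesgue_measure.-integrable `[a, u] (EFin \o f).
  apply: continuous_compact_integrable; first exact: segment_compact.
  apply: continuous_in_subspaceT => x; rewrite inE /= in_itv /= => /andP[ax xu].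
  apply: fc; rewrite /ball_ /= sub0r normrN ltr_norml.
  by move: ax xu; rewrite /a /u => ax xu; apply/andP; split; lra.
near=> x.
have /andP[ax xu] : a < x < u.
  near: x; apply: near_in_itvoo; rewrite in_itv /= /a /u; apply/andP; split; lra.
have fx : {for x, continuous f}.
  by near: x; apply/nbhs_normP; exists e.
have [F1 F2] := continuous_FTC1_closed xu fi ax fx.
apply: (@near_eq_is_derive _ _ _ (fun x => parameterized_integral lebesgue_measure a x f
                       - parameterized_integral lebesgue_measure a 0 f)).
  near=> y; rewrite (integral_from0B fi) //.
    by rewrite /a /u; apply/andP; split; lra.
  have : y \in `]a, u[ by near: y; apply: near_in_itvoo; rewrite in_itv /= ax xu.
  by rewrite in_itv /= => /andP[/ltW -> /ltW ->].
pose F y := parameterized_integral lebesgue_measure a y f.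
have G : is_derive (x : R) 1 F (f x).
  by apply: DeriveDef; [exact: F1|rewrite -derive1E; exact: F2].
clear F1 F2; rewrite -[fun y => _]/(fun y => F y - F 0); clearbody F.
rewrite -[f x]subr0; exact: (is_deriveB G (is_derive_cst (F 0) x 1)).
Unshelve. all: by end_near. Qed.

(** * First-order jets on a normed space *)

Section Jets.
Variables (R : realType) (V : normedModType R) (x0 : V).

(* [f] has value [a] and Frechet differential [l] at [x0]. Keeping the value explicit
   lets products with vanishing factors (all velocities vanish at 0) drop out. *)
Definition jet (f : V -> R) (a : R) (l : V -> R) : Prop :=
  f x0 = a /\ is_diff x0 f l.

Lemma jet_eq f a a' l l' : jet f a l -> a = a' -> l =1 l' -> jet f a' l'.
Proof. by move=> j <- /funext <-. Qed.

Lemma jet_cst a : jet (fun=> a) a (fun=> 0).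
Proof. by split=> //; exact: is_diff_cst. Qed.

Lemma jetD f g a b k l : jet f a k -> jet g b l ->
  jet (fun x => f x + g x) (a + b) (fun x => k x + l x).
Proof. by move=> [<- hf] [<- hg]; split=> //; exact: is_diffD. Qed.

Lemma jetN f a k : jet f a k -> jet (fun x => - f x) (- a) (fun x => - k x).
Proof. by move=> [<- hf]; split=> //; exact: is_diffN. Qed.

Lemma jetM f g a b k l : jet f a k -> jet g b l ->
  jet (fun x => f x * g x) (a * b) (fun x => a * l x + b * k x).
Proof. by move=> [<- hf] [<- hg]; split=> //; exact: is_diffM. Qed.

Lemma jetX2 f a k : jet f a k ->
  jet (fun x => f x ^+ 2) (a ^+ 2) (fun x => 2 * a * k x).
Proof.
move=> hf; have := jetM hf hf.
by under [X in jet _ _ X]funext do rewrite -mulrDl -mulr2n -[a *+ 2]mulr_natl.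
Qed.

Lemma jet_comp (g : R -> R) f a k (d : R) : jet f a k -> is_derive a 1 g d ->
  jet (fun x => g (f x)) (g a) (fun x => d * k x).
Proof.
move=> [<- hf] [g1 <-]; split=> //.
have hg : is_diff (f x0) g ('d g (f x0)).
  by apply: DiffDef => //; exact/derivable1_diffP.
have := is_diff_comp hf hg; rewrite -[fun x => g (f x)]/(g \o f).
move=> H; apply: (is_diff_eq H); apply/funext => x /=.
rewrite (@diff1E _ _ g (f x0)); last exact/derivable1_diffP.
by rewrite derive1E mulrC.
Qed.

(** A first-order expansion depends only on the germ of the function. This is needed because the
    explicit formulas for the residuals are established only near the equilibrium. *)
Lemma jet_near f g a l :
  (\forall x \near x0, f x = g x) -> jet f a l -> jet g a l.
Proof.
move=> fg [fa hf]; have fg0 : f x0 = g x0 by exact: (nbhs_singleton fg).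
split; first by rewrite -fg0.
have df := @ex_diff _ _ _ _ _ _ _ hf; have <- := @diff_val _ _ _ _ _ _ _ hf.
(* The expansion of [f], translated to 0, is also one of [g]; uniqueness of the differential then
   identifies the two differentials. *)
have e : g \o shift x0 = cst (g x0) + 'd f x0 +o_ (0 : V) id.
  apply/eqaddoP => eps eps0.
  have /eqaddoP /(_ _ eps0) := diff_locally df.
  have : \forall y \near (0 : V), f (y + x0) = g (y + x0).
    by move: fg; rewrite (near_shift 0 x0) subr0.
  apply: filterS2 => y fgy.
  by rewrite !fctE /= /shift /= -fgy -fg0.
have dg : 'd g x0 = 'd f x0 :> (V -> R) by apply: diff_unique => //; exact: diff_continuous.
split => //; apply/diff_locallyP; split; first by rewrite dg; exact: diff_continuous.
by rewrite dg.
Unshelve. all: by end_near. Qed.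

Lemma jet_continuous f a l : jet f a l -> f x @[x --> x0] --> a.
Proof. by move=> [<- hf]; apply: differentiable_continuous. Qed.

Lemma is_diff_row2 (f g k l : V -> R) : is_diff x0 f k -> is_diff x0 g l ->
  is_diff x0 (fun x => \row_(i < 2) (if i == 0 then f x else g x))
             (fun x => \row_(i < 2) (if i == 0 then k x else l x)).
Proof.
move=> hf hg.
have sum (u v : V -> R) : (fun x => \row_(i < 2) (if i == 0 then u x else v x)) =
    (( *:%R^~ (delta_mx 0 0)) \o u) + (( *:%R^~ (delta_mx 0 1)) \o v) :> (V -> 'rV[R]_2).
  apply/funext => x; apply/rowP => i; rewrite !fctE !mxE /=.
  by case: i => [[|[|//]] lti] /=; rewrite ?mulr1 ?mulr0 ?addr0 ?add0r.
by rewrite !sum; apply: is_diffD.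
Qed.

End Jets.

Lemma jet_linear (R : realType) (V : normedModType R) (f : V -> R) :
  linear f -> continuous f -> jet 0 f 0 f.
Proof.
move=> lf cf; pose F : {linear V -> R} :=
  HB.pack f (GRing.isLinear.Build _ _ _ _ f lf).
split; first exact: (linear0 F).
have := linear_differentiable (f := F) (0 : V) cf; have := diff_lin (f := F) (0 : V) cf.
by move=> dF F0; apply: DiffDef.
Qed.

Lemma jet_coord (R : realType) (n : nat) (i : 'I_n) :
  let V := ('rV[R]_n * 'rV[R]_n * 'rV[R]_n)%type in
  [/\ jet (0 : V) (fun x => x.1.1 0 i) 0 (fun x => x.1.1 0 i),
      jet (0 : V) (fun x => x.1.2 0 i) 0 (fun x => x.1.2 0 i) &
      jet (0 : V) (fun x => x.2 0 i) 0 (fun x => x.2 0 i)].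
Proof.
move=> V.
have cc (p : V -> 'rV[R]_n) : continuous p -> continuous (fun x => p x 0 i).
  move=> cp x; exact: (@continuous_comp V 'rV[R]_n R p (fun M => M 0 i) x
    (cp x) (@coord_continuous R 1 n 0 i (p x))).
have c1 (x : V) : {for x, continuous (fst : V -> 'rV[R]_n * 'rV[R]_n)}.
  exact: cvg_fst.
split; apply: jet_linear.
- by move=> a x y; rewrite /= !mxE.
- apply: (cc (fun x => x.1.1)) => x.
  exact: (@continuous_comp V _ 'rV[R]_n fst fst x (c1 x) (@cvg_fst _ _ _ _ _)).
- by move=> a x y; rewrite /= !mxE.
- apply: (cc (fun x => x.1.2)) => x.
  exact: (@continuous_comp V _ 'rV[R]_n fst snd x (c1 x) (@cvg_snd _ _ _ _ _)).
- by move=> a x y; rewrite /= !mxE.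
- by apply: (cc snd) => x; exact: cvg_snd.
Qed.

(** Midpoints, and the difference quotients treated next, have value 0 at the equilibrium, which
    removes most terms from later products. *)
Lemma jet_half (R : realType) (V : normedModType R) (x0 : V) (f g k l : V -> R) :
  jet x0 f 0 k -> jet x0 g 0 l ->
  jet x0 (fun x => (f x + g x) / 2) 0 (fun x => (k x + l x) / 2).
Proof.
move=> jf jg; apply: (jet_eq (jetM (jetD jf jg) (jet_cst x0 2^-1))) => [|x].
  by ring.
by rewrite mulr0 add0r mulrC.
Qed.

Lemma jet_slope (R : realType) (V : normedModType R) (x0 : V) (h : R) (f g k l : V -> R) :
  jet x0 f 0 k -> jet x0 g 0 l ->
  jet x0 (fun x => (f x - g x) / h) 0 (fun x => (k x - l x) / h).
Proof.
move=> jf jg; apply: (jet_eq (jetM (jetD jf (jetN jg)) (jet_cst x0 h^-1))) => [|x].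
  by ring.
by rewrite mulr0 add0r mulrC.
Qed.

(** * The discrete controlled Lagrangian *)

Section Lagrangian.
Variables (R : realType) (h alpha gamma kappa sigma rho : R).
Variables (beta V1 V2 Veps : R -> R).

Let c : R := gamma^-1 * (sigma^-1 - (rho - 1) / rho).
Let I : R -> R := integral_from0
        (fun z => gamma^-1 * (sigma^-1 - (rho - 1) / rho) * beta z).
Let tau := Defs.tau kappa beta.
Let Y := shifted_s gamma sigma rho beta.

Definition regular_at (p s : R) : Prop :=
  [/\ derivable beta p 1, derivable V1 p 1, is_derive p 1 I (c * beta p) &
      derivable Veps (Y p s) 1].

(** The partial derivative of [controlled_lagrangian] in [phi]; [shape_momentum] and
    [group_momentum] below are those in [dphi] and [ds]. The one in [s] is simply
    [- derive1 Veps (Y p s)]. *)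
Definition shape_force (p s v u : R) : R :=
  derive1 beta p * v * (u + tau p * v)
  + (beta p * v + gamma * (u + tau p * v)) * (kappa * derive1 beta p * v)
  + sigma * gamma * tau p * (kappa * derive1 beta p) * v ^+ 2
  - (rho - 1) * gamma * (u - (sigma - 1) * tau p * v)
    * ((sigma - 1) * (kappa * derive1 beta p) * v)
  - derive1 V1 p + derive1 Veps (Y p s) * (c * beta p).

Definition shape_momentum (p v u : R) : R :=
  alpha * v + beta p * (u + tau p * v)
  + (beta p * v + gamma * (u + tau p * v)) * tau p
  + sigma * gamma * tau p ^+ 2 * v
  - (rho - 1) * gamma * (u - (sigma - 1) * tau p * v) * ((sigma - 1) * tau p).

Definition group_momentum (p v u : R) : R :=
  beta p * v + gamma * (u + tau p * v)
  + (rho - 1) * gamma * (u - (sigma - 1) * tau p * v).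

(** The chain rule along an arbitrary curve: moving one endpoint of a discrete step changes both a
    midpoint and a velocity. *)
Lemma is_derive_controlled_lagrangian (p s v u : R -> R) (x dp ds dv du : R) :
  regular_at (p x) (s x) ->
  is_derive x 1 p dp -> is_derive x 1 s ds ->
  is_derive x 1 v dv -> is_derive x 1 u du ->
  is_derive x 1
    (fun t => controlled_lagrangian alpha gamma kappa sigma rho beta V1 V2 Veps
                (p t) (s t) (v t) (u t))
    (shape_force (p x) (s x) (v x) (u x) * dp
     - derive1 Veps (Y (p x) (s x)) * ds
     + shape_momentum (p x) (v x) (u x) * dv
     + group_momentum (p x) (v x) (u x) * du).
Proof.
move=> [bx Vx Ix ex] hp hs hv hu.
have hb := is_derive1_comp hp (is_derive1_derivable bx).
have hV := is_derive1_comp hp (is_derive1_derivable Vx).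
have hY : is_derive x 1 (fun t => Y (p t) (s t)) (ds - c * beta (p x) * dp).
  exact: is_derive1D hs (is_derive1N (is_derive1_comp hp Ix)).
have he := is_derive1_comp hY (is_derive1_derivable ex).
have ht : is_derive x 1 (fun t => tau (p t)) (kappa * (derive1 beta (p x) * dp)).
  have := is_derive1M (is_derive_cst kappa x 1) hb; rewrite mulr0 addr0; exact.
(* [F] is the controlled Lagrangian with its two [V2] terms cancelled and subtractions written as
   sums of opposites, so that the rules above match its syntax. *)
pose F t := 2^-1 * (alpha * v t ^+ 2 + 2 * beta (p t) * v t * (u t + tau (p t) * v t)
   + gamma * (u t + tau (p t) * v t) ^+ 2) + - V1 (p t)
   + 2^-1 * sigma * gamma * (tau (p t) * v t) ^+ 2
   + 2^-1 * (rho - 1) * gamma * (u t + - ((sigma - 1) * tau (p t) * v t)) ^+ 2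
   + - Veps (Y (p t) (s t)).
rewrite (_ : (fun t => _) = F); last first.
  by apply/funext => t; rewrite /F /controlled_lagrangian /lagrangian -/tau -/Y; ring.
apply: is_derive_eq.
  rewrite /F.
  repeat first [ exact: hb | exact: hV | exact: he | exact: ht | exact: hv | exact: hu
    | exact: is_derive_cst
    | apply: is_derive1D | apply: is_derive1N | apply: is_derive1X2 | apply: is_derive1M ].
by rewrite /shape_force /shape_momentum /group_momentum /GRing.scale /=; field.
Qed.

Let dL := discrete_lagrangian h alpha gamma kappa sigma rho beta V1 V2 Veps.

(** Taking one curve to be the identity and the others constant yields each partial derivative in
    the residuals. The factor [h] cancels the denominators of the velocities. *)
Lemma derive1_discrete_lagrangian (p0 s0 p1 s1 : R -> R) (x a0 b0 a1 b1 : R) :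
  let P := (p0 x + p1 x) / 2 in let S := (s0 x + s1 x) / 2 in
  let v := (p1 x - p0 x) / h in let u := (s1 x - s0 x) / h in
  regular_at P S -> h != 0 ->
  is_derive x 1 p0 a0 -> is_derive x 1 s0 b0 ->
  is_derive x 1 p1 a1 -> is_derive x 1 s1 b1 ->
  derive1 (fun t => dL (p0 t) (s0 t) (p1 t) (s1 t)) x
  = h / 2 * (shape_force P S v u * (a0 + a1) - derive1 Veps (Y P S) * (b0 + b1))
    + shape_momentum P v u * (a1 - a0) + group_momentum P v u * (b1 - b0).
Proof.
move=> P S v u reg h0 dp0 ds0 dp1 ds1.
have scale (k : R) (f : R -> R) (df : R) :
    is_derive x 1 f df -> is_derive x 1 (fun t => f t / k) (df / k).
  move=> hf; have := is_derive1M hf (is_derive_cst k^-1 x 1).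
  by rewrite mulr0 add0r mulrC.
have D := @is_derive_controlled_lagrangian
  (fun t => (p0 t + p1 t) / 2) (fun t => (s0 t + s1 t) / 2)
  (fun t => (p1 t - p0 t) / h) (fun t => (s1 t - s0 t) / h) _ _ _ _ _ reg
  (scale _ _ _ (is_derive1D dp0 dp1)) (scale _ _ _ (is_derive1D ds0 ds1))
  (scale _ _ _ (is_derive1D dp1 (is_derive1N dp0)))
  (scale _ _ _ (is_derive1D ds1 (is_derive1N ds0))).
rewrite derive1E; have [_ ->] := is_derive1M (is_derive_cst h x 1) D.
by rewrite /cst -/P -/S -/v -/u; field.
Qed.

Lemma shape_residualE (pm sm p0 s0 pp sp : R) :
  let Pm := (pm + p0) / 2 in let Sm := (sm + s0) / 2 in
  let Pp := (p0 + pp) / 2 in let Sp := (s0 + sp) / 2 in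
  let vm := (p0 - pm) / h in let um := (s0 - sm) / h in
  let vp := (pp - p0) / h in let up := (sp - s0) / h in
  let Jm := rho * gamma * (um - (sigma - 1) * tau Pm * vm) in
  let Jp := rho * gamma * (up - (sigma - 1) * tau Pp * vp) in
  regular_at Pm Sm -> regular_at Pp Sp -> h != 0 ->
  shape_residual h alpha gamma kappa sigma rho beta V1 V2 Veps pm sm p0 s0 pp sp
  = h / 2 * (shape_force Pp Sp vp up + shape_force Pm Sm vm um)
    - shape_momentum Pp vp up + shape_momentum Pm vm um
    + (1 - sigma + sigma / rho) *
      (tau Pp * (Jp + h / 2 * derive1 Veps (Y Pp Sp))
       + tau Pm * (- Jm + h / 2 * derive1 Veps (Y Pm Sm))
       - 2^-1 * (kappa * derive1 beta Pp) * Jp * (pp - p0)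
       - 2^-1 * (kappa * derive1 beta Pm) * Jm * (p0 - pm)).
Proof.
move=> Pm Sm Pp Sp vm um vp up Jm Jp rm rp h0.
have cst_ (a x : R) : is_derive x 1 (fun=> a) 0 by exact: is_derive_cst.
have id_ (x : R) : is_derive x 1 id 1 by exact: is_derive_id.
have dtau P S : regular_at P S -> derive1 tau P = kappa * derive1 beta P.
  by case=> bP _ _ _; rewrite [LHS]derive1Ml.
rewrite /shape_residual /shape_control /discrete_momentum -/Pm -/Sm -/Pp -/Sp.
rewrite (dtau _ _ rm) (dtau _ _ rp).
(* The current shape variable is the initial endpoint of the forward step and the final endpoint of
   the backward step, whence the opposite signs of the two momenta. *)
rewrite (@derive1_discrete_lagrangian id (cst s0) (cst pp) (cst sp) _ _ _ _ _ rp h0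
  (id_ _) (cst_ _ _) (cst_ _ _) (cst_ _ _)).
rewrite (@derive1_discrete_lagrangian (cst pm) (cst sm) id (cst s0) _ _ _ _ _ rm h0
  (cst_ _ _) (cst_ _ _) (id_ _) (cst_ _ _)).
rewrite /cst -/Pm -/Sm -/Pp -/Sp -/vm -/um -/vp -/up -/tau -/Y /Jm /Jp.
move: (shape_force Pp Sp vp up) (shape_force Pm Sm vm um) => fp fm.
move: (shape_momentum Pp vp up) (shape_momentum Pm vm um) => mp mm.
move: (group_momentum Pp vp up) (group_momentum Pm vm um) => gp gm.
move: (derive1 Veps (Y Pp Sp)) (derive1 Veps (Y Pm Sm)) => ep em.
move: (derive1 beta Pp) (derive1 beta Pm) (tau Pp) (tau Pm) => bp bm tp tm.
ring.
Qed.

Lemma group_residualE (pm sm p0 s0 pp sp : R) :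
  let Pm := (pm + p0) / 2 in let Sm := (sm + s0) / 2 in
  let Pp := (p0 + pp) / 2 in let Sp := (s0 + sp) / 2 in
  let vm := (p0 - pm) / h in let um := (s0 - sm) / h in
  let vp := (pp - p0) / h in let up := (sp - s0) / h in
  regular_at Pm Sm -> regular_at Pp Sp -> h != 0 ->
  group_residual h alpha gamma kappa sigma rho beta V1 V2 Veps pm sm p0 s0 pp sp
  = - (h / 2) * (derive1 Veps (Y Pp Sp) + derive1 Veps (Y Pm Sm))
    - group_momentum Pp vp up + group_momentum Pm vm um.
Proof.
move=> Pm Sm Pp Sp vm um vp up rm rp h0.
have cst_ (a x : R) : is_derive x 1 (fun=> a) 0 by exact: is_derive_cst.
have id_ (x : R) : is_derive x 1 id 1 by exact: is_derive_id.
rewrite /group_residual.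
rewrite (@derive1_discrete_lagrangian (cst p0) id (cst pp) (cst sp) _ _ _ _ _ rp h0
  (cst_ _ _) (id_ _) (cst_ _ _) (cst_ _ _)).
rewrite (@derive1_discrete_lagrangian (cst pm) (cst sm) (cst p0) id _ _ _ _ _ rm h0
  (cst_ _ _) (cst_ _ _) (cst_ _ _) (id_ _)).
rewrite /cst -/Pm -/Sm -/Pp -/Sp -/vm -/um -/vp -/up.
move: (shape_force Pp Sp vp up) (shape_force Pm Sm vm um) => fp fm.
move: (shape_momentum Pp vp up) (shape_momentum Pm vm um) => mp mm.
move: (group_momentum Pp vp up) (group_momentum Pm vm um) => gp gm.
move: (derive1 Veps (Y Pp Sp)) (derive1 Veps (Y Pm Sm)) => ep em.
ring.
Qed.

End Lagrangian.

(** * Jets of forces and momenta *)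

Section LagrangianJet.
Variables (R : realType) (alpha gamma kappa sigma rho : R).
Variables (beta V1 V2 Veps : R -> R).
Hypotheses (beta_smooth : smooth_near0 beta) (V1_smooth : smooth_near0 V1).
Hypotheses (Veps_smooth : smooth_near0 Veps).
Hypotheses (dV1_eq0 : derive1 V1 0 = 0) (dVeps_eq0 : derive1 Veps 0 = 0).

Let c : R := gamma^-1 * (sigma^-1 - (rho - 1) / rho).
Let b : R := beta 0.
Let t : R := kappa * b.

Lemma is_derive_shift_near0 : \forall x \near (0 : R), is_derive (x : R) 1
  (integral_from0 (fun z => gamma^-1 * (sigma^-1 - (rho - 1) / rho) * beta z))
  (c * beta x).
Proof.
apply: is_derive_integral_from0.
apply: filterS (smooth_derivable beta_smooth) => x bx.
apply: (@differentiable_continuous _ _ _ x (fun z => c * beta z)).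
apply/derivable1_diffP; exact: (derivableM (derivable_cst c x 1) bx).
Qed.

(** * One step: midpoint [(p, s)] and velocity [(v, u)] *)

Section Pair.
Variables (V : normedModType R) (x0 : V) (p s v u : V -> R) (lp ls lv lu : V -> R).
Hypotheses (jp : jet x0 p 0 lp) (js : jet x0 s 0 ls).
Hypotheses (jv : jet x0 v 0 lv) (ju : jet x0 u 0 lu).

Let ly x := ls x - c * b * lp x.

Lemma jet_beta : jet x0 (fun x => beta (p x)) b (fun x => derive1 beta 0 * lp x).
Proof. exact: jet_comp jp (smooth_is_derive 0 beta_smooth). Qed.

Lemma jet_tau : jet x0 (fun x => tau kappa beta (p x)) t
  (fun x => kappa * (derive1 beta 0 * lp x)).
Proof.
by apply: (jet_eq (jetM (jet_cst x0 kappa) jet_beta)) => // x; rewrite mulr0 addr0.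
Qed.

Lemma jet_dbeta : jet x0 (fun x => derive1 beta (p x)) (derive1 beta 0)
  (fun x => derive1n 2 beta 0 * lp x).
Proof. exact: jet_comp jp (smooth_is_derive 1 beta_smooth). Qed.

Lemma jet_dV1 : jet x0 (fun x => derive1 V1 (p x)) 0
  (fun x => derive1n 2 V1 0 * lp x).
Proof.
exact: jet_eq (jet_comp jp (smooth_is_derive 1 V1_smooth)) dV1_eq0 (frefl _).
Qed.

(** To first order the integral contributes its integrand at 0, namely [c * b]. *)
Lemma jet_shifted_s : jet x0 (fun x => shifted_s gamma sigma rho beta (p x) (s x)) 0 ly.
Proof.
have jI := jet_comp jp (nbhs_singleton is_derive_shift_near0).
apply: (jet_eq (jetD js (jetN jI))) => [|//].
by rewrite integral_from0_0 subr0.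
Qed.

Lemma jet_dVeps :
  jet x0 (fun x => derive1 Veps (shifted_s gamma sigma rho beta (p x) (s x))) 0
    (fun x => derive1n 2 Veps 0 * ly x).
Proof.
exact: jet_eq (jet_comp jet_shifted_s (smooth_is_derive 1 Veps_smooth))
  dVeps_eq0 (frefl _).
Qed.

Ltac jets := repeat first [ exact: jp | exact: jv | exact: ju | exact: jet_beta
  | exact: jet_tau | exact: jet_dbeta | exact: jet_dV1 | exact: jet_dVeps
  | exact: jet_cst | apply: jetD | apply: jetN | apply: jetX2 | apply: jetM ].

(** Every kinetic term is at least quadratic in the velocities and drops out. Only the potential
    terms remain, and their first derivatives vanish at 0. *)
Lemma jet_shape_force :
  jet x0 (fun x => shape_force gamma kappa sigma rho beta V1 Veps (p x) (s x) (v x) (u x))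
    0 (fun x => - (derive1n 2 V1 0 * lp x) + derive1n 2 Veps 0 * ly x * (c * b)).
Proof.
apply: jet_eq; first by rewrite /shape_force; jets.
  by rewrite -/c; ring.
move=> x; rewrite -/c -/b -/t.
move: (derive1n 2 V1 0) (derive1n 2 Veps 0) (derive1n 2 beta 0) (derive1 beta 0).
clearbody ly t b c => v2 e2 b2 b1; ring.
Qed.

(** Momenta are linear in the velocities, which vanish at the equilibrium, so [beta] and [tau] are
    frozen at their values at 0. *)
Lemma jet_shape_momentum :
  jet x0 (fun x => shape_momentum alpha gamma kappa sigma rho beta (p x) (v x) (u x))
    0 (fun x => alpha * lv x + b * (lu x + t * lv x)
       + (b * lv x + gamma * (lu x + t * lv x)) * t + sigma * gamma * t ^+ 2 * lv x
       - (rho - 1) * gamma * (lu x - (sigma - 1) * t * lv x) * ((sigma - 1) * t)).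
Proof.
apply: jet_eq; first by rewrite /shape_momentum; jets.
  by ring.
move=> x; rewrite -/b -/t; move: (derive1 beta 0).
clearbody t b => b1; ring.
Qed.

Lemma jet_group_momentum :
  jet x0 (fun x => group_momentum gamma kappa sigma rho beta (p x) (v x) (u x))
    0 (fun x => b * lv x + gamma * (lu x + t * lv x)
       + (rho - 1) * gamma * (lu x - (sigma - 1) * t * lv x)).
Proof.
apply: jet_eq; first by rewrite /group_momentum; jets.
  by ring.
move=> x; rewrite -/b -/t; move: (derive1 beta 0).
clearbody t b => b1; ring.
Qed.

(** Differentiability near 0 is pulled back along [p] and the shifted variable, both continuous at
    [x0] with value 0. *)
Lemma regular_near : \forall x \near x0,
  regular_at gamma sigma rho beta V1 Veps (p x) (s x).
Proof.
have Vy : \forall x \near x0,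
    derivable Veps (shifted_s gamma sigma rho beta (p x) (s x)) 1.
  exact: (jet_continuous jet_shifted_s (smooth_derivable Veps_smooth)).
have Vp : \forall x \near x0, derivable V1 (p x) 1.
  exact: (jet_continuous jp (smooth_derivable V1_smooth)).
have bp : \forall x \near x0, derivable beta (p x) 1.
  exact: (jet_continuous jp (smooth_derivable beta_smooth)).
have Ip : \forall x \near x0, is_derive (p x) 1
    (integral_from0 (fun z => gamma^-1 * (sigma^-1 - (rho - 1) / rho) * beta z))
    (c * beta (p x)).
  exact: (jet_continuous jp is_derive_shift_near0).
have VI : \forall x \near x0, is_derive (p x) 1
    (integral_from0 (fun z => gamma^-1 * (sigma^-1 - (rho - 1) / rho) * beta z))
    (c * beta (p x)) /\ derivable Veps (shifted_s gamma sigma rho beta (p x) (s x)) 1.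
  by move: Ip Vy; apply: filterS2 => x; exact: conj.
move: bp Vp VI; apply: filterS3 => x Hb Hp VI; exact: And4 Hb Hp VI.1 VI.2.
Qed.

End Pair.
End LagrangianJet.

(** * Linearization of the discrete system *)

Section DiscreteSystem.
Variables (R : realType) (h alpha gamma kappa sigma rho : R).
Variables (beta V1 V2 Veps : R -> R).
Hypotheses (h_neq0 : h != 0) (gamma_neq0 : gamma != 0).
Hypotheses (sigma_neq0 : sigma != 0) (rho_neq0 : rho != 0).
Hypothesis kappaE : kappa = - (gamma * sigma)^-1.
Hypotheses (beta_smooth : smooth_near0 beta) (V1_smooth : smooth_near0 V1).
Hypotheses (Veps_smooth : smooth_near0 Veps).
Hypotheses (dV1_eq0 : derive1 V1 0 = 0) (dVeps_eq0 : derive1 Veps 0 = 0).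

Let b : R := beta 0.
Let t : R := kappa * b.
(** By [kappaE], [b = - gamma * sigma * t], and twice the kinetic energy at [phi = 0] becomes [a * v
    ^ 2 + rho * gamma * (u - (sigma - 1) * t * v) ^ 2]. Thus [a] is what completing the square
    leaves. *)
Let a : R := alpha + gamma * sigma * (1 - sigma) * t ^+ 2.
Let V := ('rV[R]_2 * 'rV[R]_2 * 'rV[R]_2)%type.

(* Row vectors act from the left: (phi, s) |-> (phi, y), with y the linear part of
   [shifted_s] once [kappaE] is used. *)
Definition coupling : 'M[R]_2 := mx2 1 ((1 - sigma + sigma / rho) * t) 0 1.

(** Minus the matrix of twice the kinetic energy in the coordinates [(phi, y)], divided by [h]. *)
Definition mass : 'M[R]_2 :=
  mx2 (- ((a + sigma ^+ 2 * gamma * t ^+ 2 / rho) / h)) (sigma * gamma * t / h)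
      (sigma * gamma * t / h) (- (gamma * rho / h)).

(** Minus [h / 4] times the Hessian of the potential in [(phi, y)]: one factor 1/2 comes from the
    chain rule, the other from the midpoints. *)
Definition stiffness : 'M[R]_2 :=
  mx2 (- (h / 4 * derive1n 2 V1 0)) 0 0 (- (h / 4 * derive1n 2 Veps 0)).

(** To first order the control subtracts a multiple of the group equation from the shape equation,
    which amounts to differentiating in [phi] at fixed [y]. The equations are then already in the
    new coordinates, so [coupling] acts once, on configurations, and not by congruence. *)
Definition linear_system (q : V) : 'rV[R]_2 :=
  (q.1.1 - 2 *: q.1.2 + q.2) *m coupling *m mass
  + (q.1.1 + 2 *: q.1.2 + q.2) *m coupling *m stiffness.

Section Combination.
Variables (W : normedModType R) (x0 : W) (t0 b1p b1m : R).
Variables (fp fm mp mm ep em tp tm bp bm up um vp vm dp dm : W -> R).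
Variables (lfp lfm lmp lmm lep lem ltp ltm lbp lbm lup lum lvp lvm ldp ldm : W -> R).
Hypotheses (jfp : jet x0 fp 0 lfp) (jfm : jet x0 fm 0 lfm).
Hypotheses (jmp : jet x0 mp 0 lmp) (jmm : jet x0 mm 0 lmm).
Hypotheses (jep : jet x0 ep 0 lep) (jem : jet x0 em 0 lem).
Hypotheses (jtp : jet x0 tp t0 ltp) (jtm : jet x0 tm t0 ltm).
Hypotheses (jbp : jet x0 bp b1p lbp) (jbm : jet x0 bm b1m lbm).
Hypotheses (jup : jet x0 up 0 lup) (jum : jet x0 um 0 lum).
Hypotheses (jvp : jet x0 vp 0 lvp) (jvm : jet x0 vm 0 lvm).
Hypotheses (jdp : jet x0 dp 0 ldp) (jdm : jet x0 dm 0 ldm).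

Ltac jets := repeat first [ eassumption | exact: jet_cst
  | apply: jetD | apply: jetN | apply: jetM ].

(** The terms carrying the derivative of [tau] contain a momentum times a displacement, both zero at
    the equilibrium, and drop out. The remaining factors [tau] multiply quantities of value 0, so
    they are frozen at [t0]. *)
Lemma jet_shape_combination :
  jet x0 (fun q => h / 2 * (fp q + fm q) - mp q + mm q
    + (1 - sigma + sigma / rho) *
      (tp q * (rho * gamma * (up q - (sigma - 1) * tp q * vp q) + h / 2 * ep q)
       + tm q * (- (rho * gamma * (um q - (sigma - 1) * tm q * vm q)) + h / 2 * em q)
       - 2^-1 * (kappa * bp q) * (rho * gamma * (up q - (sigma - 1) * tp q * vp q)) * dp q
       - 2^-1 * (kappa * bm q) * (rho * gamma * (um q - (sigma - 1) * tm q * vm q)) * dm q))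
    0 (fun q => h / 2 * (lfp q + lfm q) - lmp q + lmm q
    + (1 - sigma + sigma / rho) * t0 *
      (rho * gamma * (lup q - (sigma - 1) * t0 * lvp q - (lum q - (sigma - 1) * t0 * lvm q))
       + h / 2 * (lep q + lem q))).
Proof.
apply: jet_eq; first by jets.
  by ring.
by move=> q; ring.
Qed.

Lemma jet_group_combination :
  jet x0 (fun q => - (h / 2) * (ep q + em q) - mp q + mm q)
    0 (fun q => - (h / 2) * (lep q + lem q) - lmp q + lmm q).
Proof.
apply: jet_eq; first by jets.
  by ring.
by move=> q; ring.
Qed.

End Combination.

Lemma jet_residuals :
  jet (0 : V) (fun q => shape_residual h alpha gamma kappa sigma rho beta V1 V2 Veps
    (q.1.1 0 0) (q.1.1 0 1) (q.1.2 0 0) (q.1.2 0 1) (q.2 0 0) (q.2 0 1))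
    0 (fun q => linear_system q 0 0) /\
  jet (0 : V) (fun q => group_residual h alpha gamma kappa sigma rho beta V1 V2 Veps
    (q.1.1 0 0) (q.1.1 0 1) (q.1.2 0 0) (q.1.2 0 1) (q.2 0 0) (q.2 0 1))
    0 (fun q => linear_system q 0 1).
Proof.
have [jpm jp0 jpp] := jet_coord R (0 : 'I_2).
have [jsm js0 jsp] := jet_coord R (1 : 'I_2).
have jPm := jet_half jpm jp0; have jPp := jet_half jp0 jpp.
have jSm := jet_half jsm js0; have jSp := jet_half js0 jsp.
have jvm := jet_slope h jp0 jpm; have jvp := jet_slope h jpp jp0.
have jum := jet_slope h js0 jsm; have jup := jet_slope h jsp js0.
have rm := regular_near gamma sigma rho beta_smooth V1_smooth Veps_smooth jPm jSm.
have rp := regular_near gamma sigma rho beta_smooth V1_smooth Veps_smooth jPp jSp.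
have fm := jet_shape_force gamma kappa sigma rho beta_smooth V1_smooth Veps_smooth
  dV1_eq0 dVeps_eq0 jPm jSm jvm jum.
have fp := jet_shape_force gamma kappa sigma rho beta_smooth V1_smooth Veps_smooth
  dV1_eq0 dVeps_eq0 jPp jSp jvp jup.
have mm := jet_shape_momentum alpha gamma kappa sigma rho beta_smooth jPm jvm jum.
have mp := jet_shape_momentum alpha gamma kappa sigma rho beta_smooth jPp jvp jup.
have gm := jet_group_momentum gamma kappa sigma rho beta_smooth jPm jvm jum.
have gp := jet_group_momentum gamma kappa sigma rho beta_smooth jPp jvp jup.
have em := jet_dVeps gamma sigma rho beta_smooth Veps_smooth dVeps_eq0 jPm jSm.
have ep := jet_dVeps gamma sigma rho beta_smooth Veps_smooth dVeps_eq0 jPp jSp.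
have tm := jet_tau kappa beta_smooth jPm.
have tp := jet_tau kappa beta_smooth jPp.
have dm := jet_dbeta beta_smooth jPm.
have dp := jet_dbeta beta_smooth jPp.
split.
  have jdp := jetD jpp (jetN jp0); have jdm := jetD jp0 (jetN jpm).
  rewrite oppr0 addr0 in jdp; rewrite oppr0 addr0 in jdm.
  have J := jet_shape_combination fp fm mp mm ep em tp tm dp dm jup jum jvp jvm jdp jdm.
  apply: (jet_eq (jet_near _ J)) => [|//|q].
    move: rm rp; apply: filterS2 => q rm rp.
    by apply: esym; apply: shape_residualE; [exact: rm|exact: rp|exact: h_neq0].
  rewrite /linear_system /coupling /mass /stiffness !mulmx_mx2 !mxE /=.
  (* The relation between [sigma] and [kappa] enters here: with it the coefficients match those of
     the symmetric [mass] and the diagonal [stiffness]. *)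
  rewrite /a /t /b kappaE.
  move: (beta 0) ((V1^`())^`()%classic 0) ((Veps^`())^`()%classic 0) => b0 v2 e2.
  by field; rewrite ?h_neq0 ?gamma_neq0 ?sigma_neq0 ?rho_neq0.
have J := jet_group_combination gp gm ep em.
apply: (jet_eq (jet_near _ J)) => [|//|q].
  move: rm rp; apply: filterS2 => q rm rp.
  by apply: esym; apply: group_residualE; [exact: rm|exact: rp|exact: h_neq0].
rewrite /linear_system /coupling /mass /stiffness !mulmx_mx2 !mxE /=.
rewrite /a /t /b kappaE.
move: (beta 0) ((V1^`())^`()%classic 0) ((Veps^`())^`()%classic 0) => b0 v2 e2.
by field; rewrite ?h_neq0 ?gamma_neq0 ?sigma_neq0 ?rho_neq0.
Qed.

Let system (q : V) : 'rV[R]_2 :=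
  discrete_system h alpha gamma kappa sigma rho beta V1 V2 Veps q.1.1 q.1.2 q.2.

Lemma is_diff_discrete_system : system 0 = 0 /\ is_diff (0 : V) system linear_system.
Proof.
have [[fs0 ds] [fg0 dg]] := jet_residuals.
split.
  by apply/rowP => i; rewrite [LHS]mxE [RHS]mxE; case: (i == 0); [exact: fs0|exact: fg0].
have := is_diff_row2 ds dg.
rewrite (_ : (fun x => \row_i _) = system); last first.
  by apply/funext => q; apply/rowP => i; rewrite !mxE; case: (i == 0).
rewrite (_ : (fun x => \row_i _) = linear_system) //.
apply/funext => q; apply/rowP => i; rewrite [LHS]mxE.
by case: i => [[|[|//]] lti] /=; congr (linear_system q _ _); exact/val_inj.
Qed.

End DiscreteSystem.

(** * Definiteness from the sign conditions *)

Theorem theorem5 (R : realType) (h alpha gamma kappa sigma rho : R)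
    (beta V1 V2 Veps : R -> R)
    (h_gt0 : 0 < h) (alpha_gt0 : 0 < alpha) (gamma_gt0 : 0 < gamma)
    (kappa_neq0 : kappa != 0) (sigma_neq0 : sigma != 0) (rho_neq0 : rho != 0)
    (sigmaE : sigma = - 1 / (gamma * kappa))
    (beta_smooth : smooth_near0 beta) (V1_smooth : smooth_near0 V1)
    (V2_smooth : smooth_near0 V2) (Veps_smooth : smooth_near0 Veps)
    (dV1_eq0 : derive1 V1 0 = 0) (ddV1_lt0 : derive1n 2 V1 0 < 0)
    (Veps_negdef : negative_definite Veps)
    (det_neq0 : alpha * gamma - beta 0 ^+ 2 != 0)
    (sigma_gt : - (beta 0 ^+ 2 / (alpha * gamma - beta 0 ^+ 2)) < sigma)
    (sigma_lt0 : sigma < 0) (rho_lt0 : rho < 0)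
    (ddVeps_lt0 : derive1n 2 Veps 0 < 0) :
  spectrally_stable
    (discrete_system h alpha gamma kappa sigma rho beta V1 V2 Veps) 0.
Proof.
have gamma_neq0 : gamma != 0 by rewrite gt_eqF.
have h_neq0 : h != 0 by rewrite gt_eqF.
have kappaE : kappa = - (gamma * sigma)^-1.
  by rewrite sigmaE; field; rewrite gamma_neq0 kappa_neq0.
(* Were this quantity negative, the lower bound on [sigma] would be nonnegative, contradicting
   [sigma < 0]. *)
have det_gt0 : 0 < alpha * gamma - beta 0 ^+ 2.
  rewrite lt_neqAle eq_sym det_neq0 leNgt; apply/negP => det_lt0.
  have : 0 <= - (beta 0 ^+ 2 / (alpha * gamma - beta 0 ^+ 2)).
    by rewrite -mulrN -invrN mulr_ge0 ?sqr_ge0 // invr_ge0 oppr_ge0 ltW.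
  by move=> /le_lt_trans /(_ sigma_gt) /lt_trans /(_ sigma_lt0); rewrite ltxx.
have sigma_det : 0 < sigma * (alpha * gamma - beta 0 ^+ 2) + beta 0 ^+ 2.
  by move: sigma_gt; rewrite -mulNr ltr_pdivrMr // -subr_gt0 opprK.
have [sys0 dsys] := is_diff_discrete_system alpha V2 h_neq0 gamma_neq0 sigma_neq0
  rho_neq0 kappaE beta_smooth V1_smooth Veps_smooth dV1_eq0
  (smooth_max_derive1 Veps_smooth Veps_negdef).
have [diffE valE] := dsys.
apply: (@midpoint_spectrally_stable _ _ _ (coupling kappa sigma rho beta)
  (mass h alpha gamma kappa sigma rho beta) (stiffness h V1 Veps)) => //.
- exact: mx2_shear_unit.
- apply: posdef_mx2.
    by rewrite oppr_gt0 pmulr_llt0 ?invr_gt0 // pmulr_rlt0.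
  (* The determinant of [mass] in factored form: [rho / sigma] is positive as a quotient of two
     negative numbers, and the last factor is positive by the lower bound on [sigma]. *)
  rewrite -subr_gt0 kappaE [X in 0 < X](_ : _ = rho / sigma * h ^- 2 *
    (sigma * (alpha * gamma - beta 0 ^+ 2) + beta 0 ^+ 2)).
    by rewrite mulr_gt0 // mulr_gt0 ?invr_gt0 ?exprn_gt0 // nmulr_rgt0 // invr_lt0.
  move: (beta 0) => b.
  by field; rewrite h_neq0 gamma_neq0 sigma_neq0 rho_neq0.
- have h4 : 0 < h / 4 by rewrite divr_gt0.
  move: ddV1_lt0 ddVeps_lt0; rewrite /stiffness.
  move: (derive1n 2 V1 0) (derive1n 2 Veps 0) => v e v0 e0.
  apply: posdef_mx2; first by rewrite oppr_gt0 pmulr_rlt0.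
  by rewrite expr0n /= mulrNN nmulr_rgt0 pmulr_rlt0.
- by move=> u v w; exact: (congr1 (fun f => f (u, v, w)) valE).
Qed.
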